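(* Let $(\mathfrak{g},\bullet,\langle\;,\;\rangle)$ be a metrised commutative symmetric Leibniz algebra. Then there exist a pseudo-Euclidean vector space $(A,\langle\;,\;\rangle_A)$, a vector space $\mathfrak{h}$ and a symmetric 3-linear form $T:\mathfrak{h}\times\mathfrak{h}\times\mathfrak{h}\to\mathbb{R}$ such that $(\mathfrak{g},\bullet,\langle\;,\;\rangle)$ is isomorphic to $(\mathfrak{h}\oplus A\oplus\mathfrak{h}^*,\circ,\langle\;,\;\rangle_0)$ where $\mathfrak{h}\circ\mathfrak{h}\subset\mathfrak{h}^*$ and, for any $X,Y,Z\in\mathfrak{h}$, $a\in A$, $\alpha\in\mathfrak{h}^*$, $$\langle X+a+\alpha,X+a+\alpha\rangle_0=2\alpha(X)+\langle a,a\rangle_A,\qquad \mathrm{L}_a=\mathrm{L}_\alpha=0,\qquad (X\circ Y)(Z)=T(X,Y,Z),$$ where $\mathrm{L}_a,\mathrm{L}_\alpha$ are the left multiplications for the (commutative) product $\circ$.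
   Context: Algebras and vector spaces are real and finite dimensional. A metric is a nondegenerate symmetric bilinear form; a pseudo-Euclidean vector space is a vector space with a metric. A symmetric Leibniz algebra is an algebra $(\mathfrak{g},\bullet)$ that is both left Leibniz, $u\bullet(v\bullet w)=(u\bullet v)\bullet w+v\bullet(u\bullet w)$, and right Leibniz, $(v\bullet w)\bullet u=(v\bullet u)\bullet w+v\bullet(w\bullet u)$. It is metrised when endowed with an associative metric: $\langle u\bullet v,w\rangle=\langle u,v\bullet w\rangle$ for all $u,v,w$. Commutative means $u\bullet v=v\bullet u$. Isomorphic means via a linear bijection preserving both products and metrics. *)

(* Defs.v *)
From HB Require Import structures.
From mathcomp Require Import all_boot all_order all_algebra.
From mathcomp Require Import sesquilinear reals.

Set Implicit Arguments.
Unset Strict Implicit.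
Unset Printing Implicit Defensive.

Import GRing.Theory.
Local Open Scope ring_scope.

(* Pseudo-Euclidean vector spaces are rendered by a [vectType] carrying a form
   [B : {symmetric V}] (a symmetric bilinear form) such that [nondegenerate B]. *)

Definition left_leibniz (V : zmodType) (m : V -> V -> V) : Prop :=
  forall u v w, m u (m v w) = m (m u v) w + m v (m u w).

Definition right_leibniz (V : zmodType) (m : V -> V -> V) : Prop :=
  forall u v w, m (m v w) u = m (m v u) w + m v (m w u).

Definition symmetric_leibniz (V : zmodType) (m : V -> V -> V) : Prop :=
  left_leibniz m /\ right_leibniz m.

Definition associative_form (S V : Type) (m : V -> V -> V) (B : V -> V -> S)
    : Prop :=
  forall u v w, B (m u v) w = B u (m v w).

Definition metrised_comm_symmetric_leibniz (R : realType) (g : vectType R)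
    (m : {bilinear g -> g -> g}) (B : {symmetric g}) : Prop :=
  [/\ symmetric_leibniz m, commutative m, nondegenerate B
    & associative_form m B].

Definition trilinear_form (R : realType) (h : lmodType R)
    (T : h -> h -> h -> R) : Prop :=
  [/\ forall Y Z, scalar (fun X => T X Y Z),
      forall X Z, scalar (fun Y => T X Y Z)
    & forall X Y, scalar (fun Z => T X Y Z)].

(* The two adjacent transpositions generate all permutations of the arguments. *)
Definition symmetric3 (S V : Type) (T : V -> V -> V -> S) : Prop :=
  forall X Y Z, T X Y Z = T Y X Z /\ T X Y Z = T X Z Y.

Definition metrised_isomorphic (R : realType) (g1 g2 : vectType R)
    (m1 : {bilinear g1 -> g1 -> g1}) (B1 : {symmetric g1})
    (m2 : {bilinear g2 -> g2 -> g2}) (B2 : {symmetric g2}) : Prop :=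
  exists phi : {linear g1 -> g2},
    [/\ bijective phi, {morph phi : u v / m1 u v >-> m2 u v}
      & isometry B2 B1 phi].

Notation dualspace h := 'Hom(h, (GRing.regular _)).

(* [h (+) A (+) h^*], nested as [(h * A) * h^*]. *)
Notation dsum3 h A := (h * A * dualspace h)%type.

Section Summands.
Variables (R : realType) (h A : vectType R).

Definition in_h (X : h) : dsum3 h A := (X, 0, 0).
Definition in_A (a : A) : dsum3 h A := (0, a, 0).
Definition in_dual (alpha : dualspace h) : dsum3 h A := (0, 0, alpha).

End Summands.

Arguments in_h {R h A} X.
Arguments in_A {R h A} a.
Arguments in_dual {R h A} alpha.

(* Main.v *)
Require Import Defs.
From HB Require Import structures.
From mathcomp Require Import all_boot all_order all_algebra.
From mathcomp Require Import sesquilinear reals.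

Set Implicit Arguments.
Unset Strict Implicit.
Unset Printing Implicit Defensive.

Import GRing.Theory.
Local Open Scope ring_scope.

(** Why the theorem is true.  In a commutative left Leibniz algebra the identity
    [u(vw) = (uv)w + v(uw)] says that each of the three products [u(vw)],
    [v(uw)], [w(uv)] is the sum of the other two, so all of them vanish outside
    characteristic 2 ([comm_left_leibniz_mul_mul]).  Hence every product lies in
    the annihilator [N] of the algebra.  Associativity of the metric gives
    [<uv, x> = <u, vx> = 0] for [x] in [N], so products are even orthogonal to
    [N]; conversely a vector [u] orthogonal to [N] satisfies
    [<uv, w> = <u, vw> = 0] for all [v], [w], hence lies in [N].  So [N] is
    coisotropic and its orthogonal is totally isotropic.

    Any coisotropic [N] in a pseudo-Euclidean space [V] yields a Witt splitting
    [V = h + A + h^*] with [h = V / N], [N = A + h^*] and [h^*] the orthogonal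
    of [N] ([coisotropic_splitting]).  Applied to the annihilator, it puts all
    products in [h^*] and makes [A + h^*] act by zero, so the product is
    determined by [T(X, Y, Z) = <XY, Z>] on [h].  This [T] is totally symmetric
    because the product is commutative and the metric associative.

    Taking [N], rather than the span of the products, as the starting point
    makes both inclusions above direct: no double orthogonal has to be
    computed. *)

(** * Linear and bilinear maps from their equations *)

(** The maps of the splitting depend on vectors and subspaces that are only known
    to exist, so their structures have to be obtained in the middle of a proof. *)
Section LinearBuilders.
Variable K : fieldType.

Lemma ex_linear (U W : lmodType K) (f : U -> W) :
  linear f -> exists F : {linear U -> W}, F =1 f.
Proof.
move=> lf; pose M := GRing.isLinear.Build K U W *:%R f lf.
by pose F : {linear U -> W} := HB.pack f M; exists F.
Qed.

Lemma ex_bilinear (U U' W : lmodType K) (f : U -> U' -> W) :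
  (forall v, linear (f^~ v)) -> (forall u, linear (f u)) ->
  exists F : {bilinear U -> U' -> W}, forall u v, F u v = f u v.
Proof.
move=> fl fr; pose M := bilinear_isBilinear.Build K U U' W *:%R *:%R f (fl, fr).
by pose F : {bilinear U -> U' -> W} := HB.pack f M; exists F.
Qed.

Lemma ex_symmetric (V : lmodType K) (f : V -> V -> K) :
  (forall u v, f u v = f v u) -> (forall u, scalar (f u)) ->
  exists F : {symmetric V}, forall u v, F u v = f u v.
Proof.
move=> fC fr; have fl v : scalar (f^~ v).
  by move=> a x y /=; rewrite !(fC _ v) fr.
have fC' u v : f u v = (-1) ^+ false * idfun (f v u) by rewrite mul1r.
pose M := bilinear_isBilinear.Build K V V K *%R (idfun \; *%R) f (fl, fr).
pose N := isHermitianSesquilinear.Build K V false idfun f fC'.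
by pose F : {symmetric V} := HB.pack f M N; exists F.
Qed.

End LinearBuilders.

(** * Duality for a nondegenerate form *)

Section Metric.
Variables (K : fieldType) (V : vectType K) (B : {symmetric V}).

Lemma symmetric_formC u v : B u v = B v u.
Proof. by rewrite hermC mul1r. Qed.

Lemma nondegenerateP :
  reflect (forall u, (forall v, B u v = 0) -> u = 0) (nondegenerate B).
Proof.
apply: (iffP eqP) => [rad0 u Bu0 | nd].
  by apply/eqP; rewrite -memv0 -rad0; apply/mem_orthovP => v _.
apply/eqP; rewrite -subv0; apply/subvP => u /mem_orthovP Bu0.
by rewrite memv0; apply/eqP/nd => v; apply: Bu0; rewrite memvf.
Qed.

Hypothesis Bnd : nondegenerate B.

Lemma nondegenerate_inj x y : (forall v, B x v = B y v) -> x = y.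
Proof.
move=> e; apply/eqP; rewrite -subr_eq0; apply/eqP/(nondegenerateP Bnd) => v.
by rewrite linearBl /= e subrr.
Qed.

(** The map [x |-> B x _] into the dual is injective by nondegeneracy, hence
    onto by equality of dimensions; [sharp] is its inverse. *)
Lemma ex_sharp :
  exists sharp : 'Hom('Hom(V, K^o), V), forall f v, B (sharp f) v = f v.
Proof.
pose b x := linfun (B x : V -> K^o).
have bE x v : b x v = B x v by rewrite lfunE.
have [|F FE] := @ex_linear K V 'Hom(V, K^o) b.
  by move=> a x y; apply/lfunP => v; rewrite add_lfunE scale_lfunE !bE linearPl.
have F0 : lker (linfun F) == 0%VS.
  apply/lker0P => x y; rewrite !lfunE !FE => e.
  by apply: nondegenerate_inj => v; rewrite -!bE e.
have Fsurj : limg (linfun F) = fullv.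
  apply/eqP; rewrite eqEdim subvf limg_dim_eq; last by rewrite (eqP F0) capv0.
  by rewrite !dimvf /= /dim /= muln1.
exists (linfun F)^-1%VF => f v.
have e : F ((linfun F)^-1%VF f) = f.
  by rewrite -[LHS](lfunE F) limg_lfunVK // Fsurj memvf.
by rewrite -bE -FE e.
Qed.
End Metric.

(** * Witt splitting along a coisotropic subspace *)

(** The coisotropic subspace is presented as the kernel of [pi], and [s] picks a
    complement to it. *)
Section Witt.
Variables (K : fieldType) (V h : vectType K) (B : {symmetric V}).
Variables (pi : {linear V -> h}) (s : {linear h -> V}).
Hypotheses (two_neq0 : 2 != 0 :> K) (Bnd : nondegenerate B) (sK : cancel s pi).
Hypothesis coisotropic : forall u, (forall x, pi x = 0 -> B u x = 0) -> pi u = 0.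

(** [d] embeds the dual of [h] as the orthogonal of the kernel of [pi]: it sends
    [f] to the vector representing the functional [f \o pi]. *)
Lemma ex_dual_embedding :
  exists d : {linear dualspace h -> V}, forall f v, B (d f) v = f (pi v).
Proof.
have [sharp sharpE] := ex_sharp Bnd.
pose d (f : dualspace h) := sharp (f \o linfun pi)%VF.
have dE f v : B (d f) v = f (pi v) by rewrite sharpE comp_lfunE lfunE.
have [|F FE] := @ex_linear K (dualspace h) V d; last by exists F => f v; rewrite FE.
move=> a f g; apply: (nondegenerate_inj Bnd) => v.
by rewrite linearPl /= !dE add_lfunE scale_lfunE.
Qed.

(** The given complement need not be isotropic.  Moving each [s X] by a vector of
    the orthogonal of [ker pi], which is isotropic and contained in [ker pi],
    keeps a section and can cancel the restriction of [B] to the complement: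
    each of the two cross terms contributes [- B (s X) (s Y) / 2]. *)
Lemma ex_isotropic_section (d : {linear dualspace h -> V}) :
  (forall f v, B (d f) v = f (pi v)) ->
  exists J : {linear h -> V}, cancel J pi /\ forall X Y, B (J X) (J Y) = 0.
Proof.
move=> dE.
have pid f : pi (d f) = 0 by apply: coisotropic => x x0; rewrite dE x0 linear0.
pose b X := (linfun (B (s X) : V -> K^o) \o linfun s)%VF.
have bE X Y : b X Y = B (s X) (s Y) by rewrite comp_lfunE !lfunE.
pose J X := s X - 2^-1 *: d (b X).
have [|F FE] := @ex_linear K h V J.
  move=> a X Y; rewrite /J.
  have -> : b (a *: X + Y) = a *: b X + b Y.
    by apply/lfunP => Z; rewrite add_lfunE scale_lfunE !bE linearP linearPl.
  by rewrite (linearP s) (linearP d) scalerDr opprD addrACA scalerBr !scalerA mulrC.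
exists F; split => [X | X Y].
  by rewrite FE /J linearB linearZ /= pid scaler0 subr0 sK.
rewrite !FE /J.
rewrite linearBl linearBr !linearBr /= !linearZl_LR !linearZr_LR /=.
rewrite (symmetric_formC _ (s X) (d _)) !dE !sK pid linear0 !mulr0 subr0 !bE.
rewrite (symmetric_formC _ (s Y)) -addrA -opprD -mulrDl.
by rewrite -[2^-1]mul1r -mulrDl divff // mul1r subrr.
Qed.

(** With the isotropic complement [J h] and the isotropic [d h^*] in perfect
    duality, [A] is the orthogonal of their sum, so that [V] is their direct sum.
    The components of [u] can be written down: [pi u] in [h], the functional
    [B u (J _)] in the dual of [h], and in [A] what remains. *)
Lemma coisotropic_splitting :
  exists (A : vectType K) (BA : {symmetric A})
         (phi : {linear V -> dsum3 h A}) (psi : {linear dsum3 h A -> V}),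
    [/\ cancel phi psi, cancel psi phi, nondegenerate BA,
        forall u, (phi u).1.1 = pi u
      & forall w w', B (psi w) (psi w') =
          (w.2 w'.1.1 : K) + (w'.2 w.1.1 : K) + BA w.1.2 w'.1.2].
Proof.
have [d dE] := ex_dual_embedding.
have [J [JK JJ]] := ex_isotropic_section dE.
have pid f : pi (d f) = 0 by apply: coisotropic => x x0; rewrite dE x0 linear0.
pose al u := (linfun (B u : V -> K^o) \o linfun J)%VF.
have alE u X : al u X = B u (J X) by rewrite comp_lfunE !lfunE.
have [|alL alLE] := @ex_linear K V (dualspace h) al.
  by move=> a x y; apply/lfunP => X; rewrite add_lfunE scale_lfunE !alE linearPl.
pose W := (lker (linfun pi) :&: lker (linfun alL))%VS.
have WP u : reflect (pi u = 0 /\ forall X, B u (J X) = 0) (u \in W).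
  rewrite memv_cap !memv_ker !lfunE /=; apply: (iffP andP).
    case=> /eqP-> /eqP; rewrite alLE => al0; split=> // X.
    by rewrite -alE al0 zero_lfunE.
  case=> -> al0; split=> //; apply/eqP/lfunP => X.
  by rewrite alLE alE al0 zero_lfunE.
pose A := subvs_of W.
have [||BA BAE] := @ex_symmetric K A (fun a b => B (val a) (val b)).
- by move=> a b; apply: symmetric_formC.
- by move=> a c x y; apply: linearPr.
pose psi0 (w : dsum3 h A) := J w.1.1 + val w.1.2 + d w.2.
have [|psi psiE] := @ex_linear K (dsum3 h A) V psi0.
  move=> c x y; rewrite /psi0 /= !linearP /=.
  by rewrite !scalerDr [RHS]addrACA; congr (_ + _); rewrite [RHS]addrACA.
(* [r u] is the component of [u] in [A]. *)
pose r u := u - J (pi u) - d (al u).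
have rW u : r u \in W.
  apply/WP; rewrite /r; split.
    by rewrite !linearB /= pid JK subrr subr0.
  by move=> X; rewrite !linearBl /= JJ dE JK alE subr0 subrr.
pose phi0 u : dsum3 h A := (pi u, Subvs (rW u), al u).
have phi0K : cancel phi0 psi.
  by move=> u; rewrite psiE /psi0 /= /r addrCA addrA !subrK.
have piW (a : A) : pi (val a) = 0 by case/WP: (valP a).
have BWJ (a : A) X : B (val a) (J X) = 0 by case/WP: (valP a).
(* The only nonzero pairings are those of [J] with [d] and of [A] with [A]. *)
have form w w' : B (psi w) (psi w') =
   (w.2 w'.1.1 : K) + (w'.2 w.1.1 : K) + BA w.1.2 w'.1.2.
  rewrite !psiE /psi0 !(linearDl, linearDr) /= JJ dE JK BAE BWJ !dE piW pid.
  rewrite (symmetric_formC _ (J _) (val _)) BWJ (symmetric_formC _ _ (d _)) dE JK.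
  rewrite (symmetric_formC _ (val _) (d _)) dE piW !linear0 !(addr0, add0r).
  by rewrite addrC addrA.
have psiK : cancel psi phi0.
  move=> w; have piE : pi (psi w) = w.1.1.
    by rewrite psiE /psi0 !linearD /= JK piW pid !addr0.
  have alE' : al (psi w) = w.2.
    apply/lfunP => X; rewrite alE psiE /psi0 !linearDl /= JJ BWJ dE JK.
    by rewrite !add0r.
  rewrite /phi0; case: w piE alE' => [[X a] f] /= piE alE'.
  rewrite piE alE'; congr (_, _, _); apply: val_inj.
  by rewrite /= /r piE alE' psiE /psi0 /= addrAC addrK addrC addKr.
have [|phi phiE] := @ex_linear K V (dsum3 h A) phi0.
  exact: can2_linear psiK phi0K.
exists A, BA, phi, psi; split=> //.
- by move=> u; rewrite phiE phi0K.
- by move=> w; rewrite phiE psiK.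
- apply/nondegenerateP => a BA0; have : psi (0, a, 0) = 0.
    apply: (nondegenerateP _ Bnd) => u; rewrite -[u]phi0K form /=.
    by rewrite linear0 zero_lfunE BA0 !addr0.
  by move/(congr1 phi0); rewrite psiK -[0 in RHS](linear0 psi) psiK => -[].
- by move=> u; rewrite phiE.
Qed.
End Witt.

(** A split presentation of the quotient of [V] by [lker f]: the image of [f]
    serves as the quotient, and the partial inverse of [f] as the section. *)
Lemma ex_split_quotient (K : fieldType) (V W : vectType K) (f : 'Hom(V, W)) :
  exists (h : vectType K) (pi : {linear V -> h}) (s : {linear h -> V}),
    cancel s pi /\ forall u, pi u = 0 <-> f u = 0.
Proof.
have [|pi piE] := @ex_linear K V (subvs_of (limg f)) (fun u => vsproj (limg f) (f u)).
  by move=> a u v; rewrite !linearP.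
have [|s sE] := @ex_linear K (subvs_of (limg f)) V (fun X => f^-1%VF (vsval X)).
  by move=> a u v; rewrite !linearP.
exists (subvs_of (limg f)), pi, s; split=> [X | u].
  by rewrite piE sE limg_lfunVK ?subvsP // vsvalK.
rewrite piE; split=> [/(congr1 vsval) | ->]; last exact: linear0.
by rewrite vsprojK ?memv_img ?memvf.
Qed.

(** * Commutative Leibniz algebras *)

(** Exchanging [u] and [v] in [u(vw) = w(uv) + v(uw)] and adding the two
    identities leaves [2 w(uv) = 0]. *)
Lemma comm_left_leibniz_mul_mul (K : fieldType) (V : lmodType K) (m : V -> V -> V) :
  2 != 0 :> K -> commutative m -> left_leibniz m -> forall u v w, m u (m v w) = 0.
Proof.
move=> two_neq0 mC mL u v w.
have swap x y z : m x (m y z) = m z (m x y) + m y (m x z) by rewrite mL mC.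
have : m u (m v w) *+ 2 = 0.
  apply: (addIr (m v (m w u))); rewrite add0r mulr2n -addrA.
  by rewrite [in RHS]swap (mC v w) (swap w v u) (mC w v).
rewrite -scaler_nat => /eqP; rewrite scaler_eq0 (negPf two_neq0).
by move/eqP.
Qed.

Theorem theorem3p1 (R : realType) (g : vectType R)
    (mul : {bilinear g -> g -> g}) (form : {symmetric g}) :
  metrised_comm_symmetric_leibniz mul form ->
  exists (A : vectType R) (formA : {symmetric A}) (h : vectType R)
         (T : h -> h -> h -> R)
         (circ : {bilinear (dsum3 h A) -> (dsum3 h A) -> (dsum3 h A)})
         (form0 : {symmetric (dsum3 h A)}),
    [/\ nondegenerate formA, trilinear_form T & symmetric3 T] /\
    [/\ commutative circ, nondegenerate form0
      & metrised_isomorphic mul form circ form0] /\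
    [/\ (forall X Y : h, exists beta : dualspace h,
           circ (in_h X) (in_h Y) = in_dual beta),
        (forall (X : h) (a : A) (alpha : dualspace h),
           form0 (in_h X + in_A a + in_dual alpha)
                 (in_h X + in_A a + in_dual alpha)
             = 2 * (alpha X : R) + formA a a),
        (forall (a : A) (w : dsum3 h A), circ (in_A a) w = 0),
        (forall (alpha : dualspace h) (w : dsum3 h A), circ (in_dual alpha) w = 0)
      & (forall X Y Z : h, (circ (in_h X) (in_h Y)).2 Z = T X Y Z)].
Proof.
move=> [[mL _] mC Bnd Bass].
have two_neq0 : 2 != 0 :> R by rewrite Num.Theory.pnatr_eq0.
have mul3 := comm_left_leibniz_mul_mul two_neq0 mC mL.
(* The annihilator is the kernel of [u |-> mul u], and [pi] the quotient by it. *)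
have [|ell ellE] := @ex_linear R g 'Hom(g, g) (fun u => linfun (mul u)).
  by move=> a u v; apply/lfunP => w; rewrite add_lfunE scale_lfunE !lfunE /= linearPl.
have [h [pi [s [sK pi0]]]] := ex_split_quotient (linfun ell).
have annP u : pi u = 0 <-> forall v, mul u v = 0.
  rewrite pi0 lfunE /= ellE; split=> [e v | e].
    by rewrite -(lfunE (mul u)) e zero_lfunE.
  by apply/lfunP => v; rewrite lfunE zero_lfunE /= e.
have pi_mul u v : pi (mul u v) = 0 by apply/annP => w; rewrite mC mul3.
have mul_ann u v x : pi x = 0 -> form (mul u v) x = 0.
  by move/annP => x0; rewrite Bass mC x0 linear0r.
have coiso u : (forall x, pi x = 0 -> form u x = 0) -> pi u = 0.
  move=> u0; apply/annP => v; apply: (nondegenerateP _ Bnd) => w.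
  by rewrite Bass u0.
have [A [BA [phi [psi [phiK psiK And phi1 psiB]]]]] :=
  coisotropic_splitting two_neq0 Bnd sK coiso.
have pi_psi w : pi (psi w) = w.1.1 by rewrite -phi1 psiK.
(* A product is orthogonal to [ker pi], which contains the copy of [A]. *)
have phi_mul u v : phi (mul u v) = in_dual (phi (mul u v)).2.
  have e : (phi (mul u v)).1.2 = 0.
    apply: (nondegenerateP _ And) => a.
    have := mul_ann u v (psi (in_A a)); rewrite pi_psi => /(_ erefl).
    by rewrite -{1}[mul u v]phiK psiB /= phi1 pi_mul linear0 zero_lfunE !add0r.
  by rewrite /in_dual -e -[X in (X, _, _)](pi_mul u v) -phi1 -!surjective_pairing.
have phi_mul2 u v Z : (phi (mul u v)).2 Z = form (mul u v) (psi (in_h Z)).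
  rewrite -{2}[mul u v]phiK psiB /= phi1 pi_mul zero_lfunE linear0r.
  by rewrite !addr0.
(* Product and metric are transported from [g] along the splitting. *)
have [||circ circE] := @ex_bilinear R (dsum3 h A) (dsum3 h A) (dsum3 h A)
    (fun w w' => phi (mul (psi w) (psi w'))).
- by move=> w' a x y; rewrite linearP linearPl linearP.
- by move=> w' a x y; rewrite linearP linearPr linearP.
have [||B0 B0E] := @ex_symmetric R (dsum3 h A) (fun w w' => form (psi w) (psi w')).
- by move=> w w'; apply: symmetric_formC.
- by move=> w a x y; rewrite linearP linearPr.
have circ_ann w w' : w.1.1 = 0 -> circ w w' = 0.
  by move=> w0; rewrite circE (annP _).1 ?linear0 // pi_psi.
pose T X Y Z : R := form (mul (psi (in_h X)) (psi (in_h Y))) (psi (in_h Z)).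
have in_hP a (X Y : h) : psi (in_h (a *: X + Y)) = a *: psi (in_h X) + psi (in_h Y).
  rewrite -linearP; congr (psi _).
  by congr (_, _, _); rewrite /= scaler0 addr0.
exists A, BA, h, T, circ, B0; split; [|split].
- split=> //.
  + split=> X Y a Z Z'; rewrite /T /= in_hP.
    * by rewrite !linearPl.
    * by rewrite linearPr linearPl.
    * by rewrite linearPr.
  + move=> X Y Z; rewrite /T; split; first by rewrite mC.
    by rewrite Bass mC -Bass symmetric_formC -Bass.
- split.
  + by move=> w w'; rewrite !circE mC.
  + apply/nondegenerateP => w w0; apply: (can_inj psiK); rewrite linear0.
    by apply: (nondegenerateP _ Bnd) => u; rewrite -[u]phiK -B0E.
  + exists phi; split; first by exists psi.
      by move=> u v; rewrite circE !phiK.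
    by move=> u v; rewrite B0E !phiK.
- split.
  + by move=> X Y; exists (phi (mul (psi (in_h X)) (psi (in_h Y)))).2; rewrite circE.
  + move=> X a alpha; rewrite B0E psiB /= !(addr0, add0r).
    by rewrite mulr_natl mulr2n.
  + by move=> a w; apply: circ_ann.
  + by move=> a w; apply: circ_ann.
  + by move=> X Y Z; rewrite circE phi_mul2.
Qed.
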